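(* Let $\Gamma$ be a group generated by $s_1,\dots,s_n$, let $H$ be a finitely generated normal subgroup of $\Gamma$ such that $H$ is not distorted in $\Gamma$, and let $\alpha:\Gamma\to\Gamma$ be a group endomorphism such that $\alpha(H)\subset H$. If $H$ has a complement relative to the generating system $s_1,\dots,s_n$ of $\Gamma$, then $$GR(\alpha)=\max\{GR(\alpha\text{ on }H),\ GR(\alpha\text{ on }\Gamma/H)\}.$$
   Context: For a group $G$ with finite generating set $T$ and $g\in G$, $|g|_T$ denotes the length of the shortest word in the letters $T\cup T^{-1}$ representing $g$. The growth rate of an endomorphism $\beta:G\to G$ is $GR(\beta)=\sup_{g\in G}\ \limsup_{m\to\infty}\sqrt[m]{|\beta^m(g)|_T}$. $GR(\alpha\text{ on }H)$ is the growth rate of the restriction $\alpha|_H:H\to H$ (word length with respect to a finite generating set of $H$), and $GR(\alpha\text{ on }\Gamma/H)$ is the growth rate of the endomorphism of $\Gamma/H$ induced by $\alpha$. A subgroup $H$ has a complement relative to $s_1,\dots,s_n$ if $H$ has a generating system included in $\{s_1,\dots,s_n\}$. ''Not distorted'' has its standard meaning: for finite generating sets $T$ of $H$ and $S$ of $\Gamma$ there is a constant $C$ with $|h|_T\le C|h|_S$ for all $h\in H$. *)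

(* Defs.v *)
From HB Require Import structures.
From mathcomp Require Import all_boot all_order all_algebra generic_quotient.
From mathcomp Require Import all_classical all_reals all_analysis.

Set Implicit Arguments.
Unset Strict Implicit.
Unset Printing Implicit Defensive.

Import Order.TTheory GRing.Theory Num.Theory.

Local Open Scope group_scope.
Local Open Scope quotient_scope.

(* Subgroups of a possibly infinite group are boolean predicates carrying a
   [groupClosed] structure; this is no restriction in the classical setting of
   MathComp-Analysis, where every set has a boolean membership predicate. *)
HB.mixin Record isConjgClosed (G : groupType) (S : {pred G}) := {
  gpredJ_subproof : forall g x : G, x \in S -> g^-1 * x * g \in S
}.

#[short(type="normalClosed")]
HB.structure Definition NormalClosed (G : groupType) :=
  {S of isConjgClosed G S & GroupClosed G S}.

Section SubgroupGroup.
Variables (G : groupType) (H : groupClosed G).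

Record subgroup_of :=
  Subgroup { subgroup_val : G; subgroup_valP : subgroup_val \in H }.

HB.instance Definition _ := [isSub for subgroup_val].
HB.instance Definition _ := [Choice of subgroup_of by <:].

Fact subgroup_closed : group_closed (fun x : G => x \in H).
Proof.
by split=> [|x y Hx Hy]; [apply: (@gpred1 _ H)|apply: (@gpredF _ H)].
Qed.

HB.instance Definition _ :=
  SubChoice_isSubGroup.Build G (fun x : G => x \in H) subgroup_of
    subgroup_closed.

End SubgroupGroup.

Section QuotientGroup.
Variables (G : groupType) (H : normalClosed G).

Definition coset_rel : rel G := fun x y => x^-1 * y \in H.

Fact coset_rel_refl : reflexive coset_rel.
Proof. by move=> x; rewrite /coset_rel mulVg gpred1. Qed.

Fact coset_rel_imp x y : coset_rel x y -> coset_rel y x.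
Proof. by rewrite /coset_rel => /(@gpredVr _ H); rewrite invgM invgK. Qed.

Fact coset_rel_sym : symmetric coset_rel.
Proof. by move=> x y; apply/idP/idP; apply: coset_rel_imp. Qed.

Fact coset_rel_trans : transitive coset_rel.
Proof.
move=> y x z xy yz; rewrite /coset_rel.
have -> : x^-1 * z = (x^-1 * y) * (y^-1 * z) by rewrite mulgA mulgK.
exact: gpredM.
Qed.

Canonical coset_equiv :=
  EquivRel coset_rel coset_rel_refl coset_rel_sym coset_rel_trans.

Definition quotient_by := {eq_quot coset_equiv}.

HB.instance Definition _ := Choice.on quotient_by.
HB.instance Definition _ := EqQuotient.on quotient_by.

Lemma pi_quotientP (x y : G) :
  reflect (\pi_quotient_by x = \pi_quotient_by y) (x^-1 * y \in H).
Proof. exact: (@eqmodP _ coset_equiv x y). Qed.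

Lemma repr_pi (x : G) : x^-1 * repr (\pi_quotient_by x) \in H.
Proof. by apply/pi_quotientP; rewrite reprK. Qed.

Definition quot_one : quotient_by := \pi_quotient_by 1.
Definition quot_mul (a b : quotient_by) : quotient_by :=
  \pi_quotient_by (repr a * repr b).
Definition quot_inv (a : quotient_by) : quotient_by :=
  \pi_quotient_by (repr a)^-1.

Fact pi_mul (x y : G) :
  quot_mul (\pi_quotient_by x) (\pi_quotient_by y) = \pi_quotient_by (x * y).
Proof.
apply/esym/pi_quotientP; set x' := repr _; set y' := repr _.
have -> : (x * y)^-1 * (x' * y') = (y^-1 * (x^-1 * x') * y) * (y^-1 * y').
  by rewrite invgM !mulgA mulgK.
by apply: gpredM; [apply: gpredJ_subproof|]; apply: repr_pi.
Qed.

Fact pi_inv (x : G) :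
  quot_inv (\pi_quotient_by x) = \pi_quotient_by x^-1.
Proof.
apply/pi_quotientP; set x' := repr _; rewrite invgK.
have -> : x' * x^-1 = (x^-1)^-1 * (x^-1 * x') * x^-1.
  by rewrite invgK mulgA mulgV mul1g.
by apply: gpredJ_subproof; apply: repr_pi.
Qed.

Fact quot_mulA : associative quot_mul.
Proof.
move=> a b c; rewrite -[a]reprK -[b]reprK -[c]reprK.
by rewrite (pi_mul (repr b)) (pi_mul (repr a) (repr b)) !pi_mul mulgA.
Qed.

Fact quot_mul1 : left_id quot_one quot_mul.
Proof. by move=> a; rewrite -[a]reprK pi_mul mul1g. Qed.

Fact quot_mulr1 : right_id quot_one quot_mul.
Proof. by move=> a; rewrite -[a]reprK pi_mul mulg1. Qed.

Fact quot_mulV : left_inverse quot_one quot_inv quot_mul.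
Proof. by move=> a; rewrite -[a]reprK pi_inv pi_mul mulVg. Qed.

Fact quot_mulrV : right_inverse quot_one quot_inv quot_mul.
Proof. by move=> a; rewrite -[a]reprK pi_inv pi_mul mulgV. Qed.

HB.instance Definition _ := isGroup.Build quotient_by
  quot_mulA quot_mul1 quot_mulr1 quot_mulV quot_mulrV.

Lemma pi_quotientM (x y : G) :
  \pi_quotient_by (x * y) = \pi_quotient_by x * \pi_quotient_by y.
Proof. exact/esym/pi_mul. Qed.

Lemma pi_quotientF (x y : G) :
  \pi_quotient_by (x / y) = \pi_quotient_by x / \pi_quotient_by y.
Proof. by rewrite pi_quotientM -pi_inv. Qed.

End QuotientGroup.

(* A unital magma morphism between groups is exactly a group homomorphism. *)
Notation group_endo G := (UMagmaMorphism.type G G).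

Section InducedEndomorphisms.
Variables (G : groupType) (alpha : group_endo G).

Section Restriction.
Variables (H : groupClosed G) (alphaH : forall x, x \in H -> alpha x \in H).

Definition restrict_endo (x : subgroup_of H) : subgroup_of H :=
  Subgroup (alphaH (valP x)).

Fact restrict_endoF : {morph restrict_endo : x y / x / y}.
Proof. by move=> x y; apply: val_inj; rewrite /= !gmulfF. Qed.

HB.instance Definition _ :=
  isGroupMorphism.Build (subgroup_of H) (subgroup_of H) restrict_endo
    restrict_endoF.

End Restriction.

Section Quotient.
Variables (H : normalClosed G) (alphaH : forall x, x \in H -> alpha x \in H).

(* [alphaH] is unused in the formula but makes the map well defined, see
   [quotient_endoE]. *)
Definition quotient_endo of (forall x, x \in H -> alpha x \in H) :=
  fun a : quotient_by H => \pi_(quotient_by H) (alpha (repr a)).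

Lemma quotient_endoE (x : G) :
  quotient_endo alphaH (\pi_(quotient_by H) x)
  = \pi_(quotient_by H) (alpha x).
Proof.
apply/esym/pi_quotientP; set x' := repr _.
by rewrite -gmulfV -gmulfM; apply/alphaH/repr_pi.
Qed.

Fact quotient_endoF : {morph quotient_endo alphaH : a b / a / b}.
Proof.
move=> a b; rewrite -[a]reprK -[b]reprK -pi_quotientF !quotient_endoE.
by rewrite -pi_quotientF gmulfF.
Qed.

HB.instance Definition _ :=
  isGroupMorphism.Build (quotient_by H) (quotient_by H)
    (quotient_endo alphaH) quotient_endoF.

End Quotient.
End InducedEndomorphisms.

Section WordLength.
Variable G : groupType.
Implicit Types (T : seq G) (g : G).

Definition word_repr T g (n : nat) : Prop :=
  exists w : seq G,
    [/\ size w = n,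
        forall x, x \in w -> x \in T \/ x^-1 \in T
      & \prod_(x <- w) x = g].

Definition generates T : Prop := forall g, exists n, word_repr T g n.

Definition finitely_generated : Prop := exists T, generates T.

(* Junk value 0 when no word in T and its inverses represents g. *)
Definition word_length T g : nat :=
  xget 0%N [set n | word_repr T g n /\
                    forall m, word_repr T g m -> (n <= m)%N].

End WordLength.

Definition has_complement (G : groupType) (H : groupClosed G) (s : seq G) :
    Prop :=
  exists T : seq (subgroup_of H),
    generates T /\ forall t, t \in T -> val t \in s.

Local Open Scope ring_scope.

Definition undistorted (R : realType) (G : groupType) (H : groupClosed G) :
    Prop :=
  forall (T : seq (subgroup_of H)) (S : seq G), generates T -> generates S ->
  exists C : R, forall h : subgroup_of H,
    (word_length T h)%:R <= C * (word_length S (val h))%:R.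

(* The term of index m = 0 is 1 by convention and does not affect the upper
   limit. *)
Definition growth_rate (R : realType) (G : groupType) (T : seq G)
    (beta : group_endo G) : \bar R :=
  ereal_sup (range (fun g : G =>
    limn_esup (fun m : nat =>
      ((word_length T (iter m beta g))%:R `^ (m%:R^-1))%:E))).

(* Main.v *)
Require Import Defs.
From HB Require Import structures.
From mathcomp Require Import all_boot all_order all_algebra generic_quotient.
From mathcomp Require Import all_classical all_reals all_analysis.
From mathcomp Require Import ring lra.

Set Implicit Arguments.
Unset Strict Implicit.
Unset Printing Implicit Defensive.

Import Order.TTheory GRing.Theory Num.Theory.

Local Open Scope classical_set_scope.
Local Open Scope ring_scope.

(** Write |.|_S, |.|_T, |.|_U for the word lengths of Gamma, H and Gamma/H.

    The inequalities GR(alpha on H) <= GR(alpha) and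
    GR(alpha on Gamma/H) <= GR(alpha) hold because |h|_T is at most a constant
    times |h|_S, H being undistorted, and because the projection Gamma ->
    Gamma/H is Lipschitz.

    For the converse, fix g and a real l > 0 larger than both growth rates.
    The coset of alpha^m(g) has U-length O(l^m), so it has a representative w_m
    with |w_m|_S = O(l^m) ([word_length_lift]).  Write
    alpha^m(g) = w_m h_m with h_m in H.  Comparing two consecutive
    decompositions gives
      h_(m+1) = k_m alpha(h_m)   with   k_m = w_(m+1)^-1 alpha(w_m) in H.
    The S-length of k_m is O(l^m), and it is here that non-distortion is
    decisive: it yields |k_m|_T = O(l^m).  Unfolding the recurrence,
      h_m = k_(m-1) alpha(k_(m-2)) ... alpha^(m-1)(k_0) alpha^m(h_0).
    As l exceeds the growth rate on H, alpha^j stretches T-lengths by at most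
    O(l^j), uniformly over H ([growth_rate_lt_unif]); hence each of the
    m + 1 factors has T-length O(l^m), and |h_m|_T = O((m + 1) l^m)
    ([twisted_product_growth]).  So |alpha^m(g)|_S = O((m + 1) l^m), and the
    linear factor disappears when m-th roots are taken
    ([growth_rate_le]). *)

(** * Word length *)

(** Makes constants that exist separately for each generator uniform over a
    finite generating set. *)
Lemma seq_bound (R : realType) (I : eqType) (s : seq I) (P : I -> R -> Prop) :
  (forall x c d, P x c -> c <= d -> P x d) ->
  (forall x, x \in s -> exists c, P x c) ->
  exists2 c, 0 <= c & forall x, x \in s -> P x c.
Proof.
move=> Pmono; elim: s => [|x s IHs] exP; first by exists 0.
have [y ys|c c0 Pc] := IHs; first by apply: exP; rewrite inE ys orbT.
have [d Pd] := exP x (mem_head _ _).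
exists (Num.max c d) => [|y]; first by rewrite le_max c0.
rewrite inE => /predU1P[->|/Pc Py].
  by apply: Pmono Pd _; rewrite le_max lexx orbT.
by apply: Pmono Py _; rewrite le_max lexx.
Qed.

Section WordLengthTheory.
Variables (G : groupType) (T : seq G).
Implicit Types g h : G.

Lemma word_repr1 : word_repr T 1%g 0.
Proof. by exists [::]; split=> //; rewrite big_nil. Qed.

Lemma word_reprM g h m n :
  word_repr T g m -> word_repr T h n -> word_repr T (g * h)%g (m + n).
Proof.
move=> [v [<- vT <-]] [w [<- wT <-]]; exists (v ++ w).
split; rewrite ?size_cat ?big_cat // => x.
by rewrite mem_cat => /orP[/vT|/wT].
Qed.

Lemma word_reprV g n : word_repr T g n -> word_repr T g^-1%g n.
Proof.
move=> [w [<- wT <-]]; elim: w wT => [|x w IHw] wT.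
  by rewrite big_nil invg1; exact: word_repr1.
rewrite big_cons invgM /= -addn1; apply: word_reprM.
  by apply: IHw => y yw; apply: wT; rewrite inE yw orbT.
exists [:: x^-1%g]; split=> //; last by rewrite big_seq1.
move=> y; rewrite inE => /eqP ->; rewrite invgK.
by case: (wT x (mem_head _ _)); [right|left].
Qed.

Lemma word_length_spec g n : word_repr T g n ->
  word_repr T g (word_length T g) /\
  (forall m, word_repr T g m -> (word_length T g <= m)%N).
Proof.
move=> gn.
have ex : exists n, `[< word_repr T g n >] by exists n; apply/asboolP.
case: (ex_minnP ex) => k /asboolP gk kmin.
apply: (@xgetPex _ 0%N [set n | word_repr T g n /\
  forall m, word_repr T g m -> (n <= m)%N]).
by exists k; split=> // m gm; apply/kmin/asboolP.
Qed.

Lemma word_length_min g n : word_repr T g n -> (word_length T g <= n)%N.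
Proof. by move=> gn; apply: (word_length_spec gn).2. Qed.

Lemma word_length1 : word_length T 1%g = 0%N.
Proof. by apply/eqP; rewrite -leqn0; apply/word_length_min/word_repr1. Qed.

Hypothesis genT : generates T.

Lemma word_lengthP g : word_repr T g (word_length T g).
Proof. by have [n /word_length_spec[]] := genT g. Qed.

Lemma word_lengthM g h :
  (word_length T (g * h)%g <= word_length T g + word_length T h)%N.
Proof. by apply/word_length_min/word_reprM; exact: word_lengthP. Qed.

Lemma word_lengthV_le g : (word_length T g^-1%g <= word_length T g)%N.
Proof. by apply/word_length_min/word_reprV/word_lengthP. Qed.

End WordLengthTheory.

Section Morphisms.
Variables (R : realType) (G G' : groupType) (f : G -> G').
Hypothesis fM : {morph f : x y / (x * y)%g >-> (x * y)%g}.

Lemma morph_one : f 1%g = 1%g.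
Proof. by apply: (mulgI (f 1%g)); rewrite -fM !mulg1. Qed.

Lemma morph_inv x : f x^-1%g = (f x)^-1%g.
Proof. by apply: (mulgI (f x)); rewrite -fM !mulgV morph_one. Qed.

(** The constant depends only on the values on generators; applied to the
    iterates of an endomorphism, this makes growth bounds uniform in [g]. *)
Lemma word_length_morph (T : seq G) (T' : seq G') (K : R) :
  generates T -> generates T' ->
  (forall t, t \in T -> (word_length T' (f t))%:R <= K) ->
  forall g, (word_length T' (f g))%:R <= K * (word_length T g)%:R.
Proof.
move=> genT genT' leK g; have [w [<- wT <-]] := word_lengthP genT g.
elim: w wT => [|x w IHw] wT.
  by rewrite big_nil morph_one word_length1 mulr0.
rewrite big_cons fM /= -[in leRHS]add1n natrD mulrDr mulr1.
apply: (@le_trans _ _ ((word_length T' (f x))%:R +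
                       (word_length T' (f (\prod_(y <- w) y)%g))%:R)).
  by rewrite -natrD ler_nat; exact: word_lengthM.
apply: lerD; last by apply: IHw => y yw; apply: wT; rewrite inE yw orbT.
have [/leK //|/leK] := wT x (mem_head _ _); apply: le_trans.
by rewrite morph_inv ler_nat -{1}[f x]invgK word_lengthV_le.
Qed.

Lemma word_length_lipschitz (T : seq G) (T' : seq G') :
  generates T -> generates T' ->
  exists2 K : R, 0 <= K &
    forall g, (word_length T' (f g))%:R <= K * (word_length T g)%:R.
Proof.
move=> genT genT'.
have [||K K0 leK] := @seq_bound R _ T (fun t c => (word_length T' (f t))%:R <= c).
- by move=> x c d; exact: le_trans.
- by move=> x _; exists (word_length T' (f x))%:R.
by exists K => //; exact: word_length_morph.
Qed.

(** Lift a geodesic word of [a] letter by letter. *)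
Lemma word_length_lift (T : seq G) (T' : seq G') :
  generates T -> generates T' -> (forall a, exists g, f g = a) ->
  exists2 K : R, 0 <= K & forall a, exists2 g, f g = a &
    (word_length T g)%:R <= K * (word_length T' a)%:R.
Proof.
move=> genT genT' fsurj.
have [||K K0 leK] := @seq_bound R _ T'
  (fun a c => exists2 g, f g = a & (word_length T g)%:R <= c).
- by move=> a c d [g <- gc] cd; exists g => //; exact: le_trans cd.
- by move=> a _; have [g <-] := fsurj a; exists (word_length T g)%:R, g.
exists K => // a; have [w [<- wT <-]] := word_lengthP genT' a.
elim: w wT => [|x w IHw] wT.
  by rewrite big_nil; exists 1%g; rewrite ?morph_one// word_length1 mulr0.
have [y yw|g fg leg] := IHw; first by apply: wT; rewrite inE yw orbT.
have [u fu leu] : exists2 u, f u = x & (word_length T u)%:R <= K.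
  have [/leK //|/leK[u fu leu]] := wT x (mem_head _ _).
  exists u^-1%g; first by rewrite morph_inv fu invgK.
  by apply: le_trans leu; rewrite ler_nat word_lengthV_le.
exists (u * g)%g; first by rewrite fM fu fg big_cons.
rewrite /= -[in leRHS]add1n natrD mulrDr mulr1.
apply: le_trans (lerD leu leg).
by rewrite -natrD ler_nat word_lengthM.
Qed.

End Morphisms.

Lemma iter_morph (G : groupType) (f : G -> G) m :
  {morph f : x y / (x * y)%g} -> {morph iter m f : x y / (x * y)%g}.
Proof. by move=> fM x y; elim: m => //= m ->; rewrite fM. Qed.

(** * Growth rates and geometric bounds *)

Section GeometricBounds.
Variable R : realType.

Lemma bernoulli_le (t : R) m : 1 <= t -> m%:R * (t - 1) <= t ^+ m.
Proof.
move=> t1; elim: m => [|m IHm]; first by rewrite mul0r expr0.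
have tm : 1 <= t ^+ m by exact: exprn_ege1.
rewrite exprS -natr1; nra.
Qed.

(** Bernoulli's inequality for the square root of [q] makes [q ^+ m] grow at
    least quadratically, which beats an affine function of [m]. *)
Lemma affine_le_geometric (P Q q : R) : 1 < q ->
  exists N : nat, forall m, (N <= m)%N -> P + m%:R * Q <= q ^+ m.
Proof.
move=> q1; have t1 : 1 < Num.sqrt q by rewrite -sqrtr1 ltr_sqrt// (lt_trans _ q1).
set t := Num.sqrt q in t1 *.
have qE : q = t ^+ 2 by rewrite sqr_sqrtr// ltW// (lt_trans _ q1).
pose c := (`|P| + `|Q|) / (t - 1) ^+ 2.
exists (Num.truncn c).+1 => m Nm.
have cm : c <= m%:R.
  by apply: (le_trans (ltW (truncnS_gt _))); rewrite ler_nat.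
have e0 : 0 < (t - 1) ^+ 2 by rewrite exprn_gt0 // subr_gt0.
rewrite ler_pdivrMr// in cm.
have m1 : 1 <= m%:R :> R by rewrite ler1n; exact: leq_ltn_trans Nm.
have := bernoulli_le m (ltW t1); rewrite qE -exprM mulnC exprM => tm.
have tm2 : (m%:R * (t - 1)) ^+ 2 <= (t ^+ m) ^+ 2.
  by rewrite lerXn2r// nnegrE ?exprn_ge0 ?mulr_ge0// ?subr_ge0; lra.
apply: le_trans tm2; rewrite exprMn.
have Pn := ler_norm P; have Qn := ler_norm Q.
have Pn0 := normr_ge0 P; have Qn0 := normr_ge0 Q.
apply: (@le_trans _ _ (m%:R * (`|P| + `|Q|))); first by nra.
by rewrite [m%:R ^+ 2]expr2 -mulrA ler_wpM2l.
Qed.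

Lemma ler_root (x y : R) m : (0 < m)%N -> 0 <= x -> 0 <= y ->
  (x `^ m%:R^-1 <= y) = (x <= y ^+ m).
Proof.
move=> m0 x0 y0; rewrite -[LHS](@ler_pXn2r _ m)// ?nnegrE ?powR_ge0//.
have -> : (x `^ m%:R^-1) ^+ m = x; last by [].
by rewrite -powR_mulrn ?powR_ge0// -powRrM mulVf ?pnatr_eq0 -?lt0n// powRr1.
Qed.

End GeometricBounds.

Section GrowthRate.
Variables (R : realType) (G : groupType) (T : seq G) (beta : group_endo G).

Lemma growth_rate_ge0 : (0 <= growth_rate R T beta)%E.
Proof.
apply: le_trans (ereal_sup_ubound _); last by exists 1%g.
apply: limf_esup_ge0 => [[N _ /(_ N (leqnn N))]//|m].
by rewrite lee_fin powR_ge0.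
Qed.

(** Beyond some rank the bound holds with constant 1; the finitely many earlier
    terms are absorbed in [C]. *)
Lemma growth_rate_lt (l : R) g : 0 < l -> (growth_rate R T beta < l%:E)%E ->
  exists2 C, 0 <= C & forall m, (word_length T (iter m beta g))%:R <= C * l ^+ m.
Proof.
move=> l0 GRl.
have : (limn_esup (fun m => ((word_length T (iter m beta g))%:R `^ m%:R^-1)%:E)
        < l%:E :> \bar R)%E.
  by apply: le_lt_trans GRl; apply: ereal_sup_ubound; exists g.
move=> /ereal_inf_lt[_ [V [N _ NV] <-]] supV.
have tail m : (N < m)%N -> (word_length T (iter m beta g))%:R <= l ^+ m.
  move=> Nm; rewrite -ler_root// ?(ltW l0)// ?(leq_ltn_trans _ Nm)//.
  rewrite -lee_fin; apply: le_trans (ltW supV); apply: ereal_sup_ubound.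
  by exists m => //; apply: NV; exact: ltnW.
have [||C C0 CP] := @seq_bound R _ (iota 0 N.+1)
    (fun m c => (word_length T (iter m beta g))%:R <= c * l ^+ m).
- by move=> m c d /le_trans + cd; apply; rewrite ler_wpM2r// exprn_ge0// ltW.
- move=> m _; exists ((word_length T (iter m beta g))%:R / l ^+ m).
  by rewrite divfK// lt0r_neq0// exprn_gt0.
exists (C + 1) => [|m]; first by rewrite addr_ge0.
have lm : 0 <= l ^+ m by rewrite exprn_ge0// ltW.
have [mN|Nm] := leqP m N.
  by apply: (le_trans (CP m _)); rewrite ?mem_iota// ler_wpM2r// lerDl.
by apply: (le_trans (tail m Nm)); rewrite ler_peMl// lerDr.
Qed.

(** A converse of [growth_rate_lt] that tolerates an affine factor, since
    the geometric rate [l] may be taken arbitrarily close to [M]. *)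
Lemma growth_rate_le (M : \bar R) : (0 <= M)%E ->
  (forall l, 0 < l -> (M < l%:E)%E -> forall g, exists P Q, forall m,
     (word_length T (iter m beta g))%:R <= (P + m%:R * Q) * l ^+ m) ->
  (growth_rate R T beta <= M)%E.
Proof.
case: M => [M||] // M0 bnd; last by rewrite leey.
rewrite lee_fin in M0.
apply: ge_ereal_sup => _ [g _ <-]; apply/lee_addgt0Pr => e e0.
(* The gap between l and M + e is what pays for the affine factor. *)
pose l := M + e / 2; have l0 : 0 < l by rewrite /l; lra.
have [||P [Q PQ]] := bnd l _ _ g => //; first by rewrite lte_fin /l; lra.
have [|N NP] := @affine_le_geometric R P Q ((M + e) / l).
  by rewrite ltr_pdivlMr// /l; lra.
apply: ge_ereal_inf.
exists (ereal_sup [set ((word_length T (iter m beta g))%:R `^ m%:R^-1)%:E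
                  | m in [set m | (N < m)%N]]).
  by exists [set m | (N < m)%N] => //; exists N.+1.
apply: ge_ereal_sup => _ [m /= Nm <-]; rewrite -EFinD lee_fin.
rewrite ler_root// ?(leq_ltn_trans _ Nm)//; last by lra.
apply: (le_trans (PQ m)).
have lm : 0 < l ^+ m by rewrite exprn_gt0.
by rewrite -ler_pdivlMr// -expr_div_n; apply/NP/ltnW.
Qed.

(** It suffices to bound the orbits of the generators, as the iterates of [beta]
    are morphisms. *)
Lemma growth_rate_lt_unif (l : R) : generates T -> 0 < l ->
  (growth_rate R T beta < l%:E)%E ->
  exists2 A, 0 <= A & forall j g,
    (word_length T (iter j beta g))%:R <= A * l ^+ j * (word_length T g)%:R.
Proof.
move=> genT l0 GRl.
have [||A A0 AP] := @seq_bound R _ T (fun t c => forall j,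
    (word_length T (iter j beta t))%:R <= c * l ^+ j).
- move=> t c d tc cd j; apply: (le_trans (tc j)).
  by rewrite ler_wpM2r// exprn_ge0// ltW.
- by move=> t _; have [C _ CP] := growth_rate_lt t l0 GRl; exists C.
exists A => // j g; apply: word_length_morph => //; last by move=> t /AP.
by apply: iter_morph => x y; rewrite gmulfM.
Qed.

(** The recurrence unfolds to
      h m = k (m-1) * beta (k (m-2)) * ... * beta^m (h 0),
    in which the factor coming from [k i] has length at most
    A l^(m-1-i) * E l^i = (A E / l) l^m. *)
Lemma twisted_product_growth (A E l : R) (h k : nat -> G) :
  generates T -> 0 < l -> 0 <= A ->
  (forall j g,
    (word_length T (iter j beta g))%:R <= A * l ^+ j * (word_length T g)%:R) ->
  (forall m, h m.+1 = k m * beta (h m))%g ->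
  (forall m, (word_length T (k m))%:R <= E * l ^+ m) ->
  forall m, (word_length T (h m))%:R <=
    (A * (word_length T (h 0%N))%:R + m%:R * (A * E / l)) * l ^+ m.
Proof.
move=> genT l0 A0 Ag hS kE m.
(* The induction needs the bound for all the beta-iterates of h m at once. *)
suff /(_ m 0%N) : forall m j, (word_length T (iter j beta (h m)))%:R <=
    (A * (word_length T (h 0%N))%:R + m%:R * (A * E / l)) * l ^+ (m + j).
  by rewrite addn0.
elim=> [|{}m IHm] j; first by rewrite mul0r addr0 add0n mulrAC.
have betaM : {morph iter j beta : x y / (x * y)%g}.
  by apply: iter_morph => x y; rewrite gmulfM.
rewrite hS betaM -iterSr.
apply: (@le_trans _ _ ((word_length T (iter j beta (k m)))%:R +
                       (word_length T (iter j.+1 beta (h m)))%:R)).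
  by rewrite -natrD ler_nat word_lengthM.
have lj : 0 <= A * l ^+ j by rewrite mulr_ge0// exprn_ge0// ltW.
have := IHm j.+1; rewrite addnS addSn => IH.
have kj : (word_length T (iter j beta (k m)))%:R <= A * E / l * l ^+ (m + j).+1.
  apply: (le_trans (Ag _ _)).
  apply: (le_trans (ler_wpM2l lj (kE m))).
  rewrite exprS exprD le_eqVlt; apply/orP; left; apply/eqP.
  by field; exact: lt0r_neq0.
apply: (le_trans (lerD kj IH)).
by rewrite -natr1 le_eqVlt; apply/orP; left; apply/eqP; ring.
Qed.

End GrowthRate.

(** * Extensions by an undistorted normal subgroup *)

Section Extension.
Variables (R : realType) (G : groupType) (H : normalClosed G).
Variables (alpha : group_endo G).
Variable alphaH : forall x : G, x \in H -> alpha x \in H.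
Variables (S : seq G) (T : seq (subgroup_of H)) (U : seq (quotient_by H)).
Hypotheses (genS : generates S) (genT : generates T) (genU : generates U).

Let piH (x : G) : quotient_by H := \pi_(quotient_by H)%qT x.

Let piHM : {morph piH : x y / (x * y)%g >-> (x * y)%g}.
Proof. exact: pi_quotientM. Qed.

Lemma iter_restrict_endo m (h : subgroup_of H) :
  val (iter m (restrict_endo alphaH) h) = iter m alpha (val h).
Proof. by elim: m => //= m ->. Qed.

Lemma iter_quotient_endo m x :
  iter m (quotient_endo alphaH) (piH x) = piH (iter m alpha x).
Proof. by elim: m => //= m ->; rewrite /piH quotient_endoE. Qed.

Lemma growth_rate_quotient_le :
  (growth_rate R U (quotient_endo alphaH) <= growth_rate R S alpha)%E.
Proof.
apply: growth_rate_le; first exact: growth_rate_ge0.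
move=> l l0 GRl a.
have [K K0 KP] := word_length_lipschitz R piHM genS genU.
rewrite -[a]reprK -/(piH _).
have [C C0 CP] := growth_rate_lt (repr a) l0 GRl.
exists (K * C), 0 => m; rewrite iter_quotient_endo mulr0 addr0 -mulrA.
by apply: (le_trans (KP _)); rewrite ler_wpM2l.
Qed.

Hypothesis undistH : undistorted R H.

Lemma undistorted_bound : exists2 C : R, 0 <= C & forall h : subgroup_of H,
  (word_length T h)%:R <= C * (word_length S (val h))%:R.
Proof.
(* The distortion constant may be negative when H is trivial. *)
have [C CP] := undistH genT genS; exists `|C| => // h.
by apply: (le_trans (CP h)); rewrite ler_wpM2r// ler_norm.
Qed.

Lemma growth_rate_restrict_le :
  (growth_rate R T (restrict_endo alphaH) <= growth_rate R S alpha)%E.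
Proof.
apply: growth_rate_le; first exact: growth_rate_ge0.
move=> l l0 GRl h; have [K K0 KP] := undistorted_bound.
have [C C0 CP] := growth_rate_lt (val h) l0 GRl.
exists (K * C), 0 => m; rewrite mulr0 addr0 -mulrA.
by apply: (le_trans (KP _)); rewrite iter_restrict_endo ler_wpM2l.
Qed.

Lemma growth_rate_le_max :
  (growth_rate R S alpha <= maxe (growth_rate R T (restrict_endo alphaH))
                                 (growth_rate R U (quotient_endo alphaH)))%E.
Proof.
apply: growth_rate_le; first by rewrite le_max growth_rate_ge0.
move=> l l0; rewrite gt_max => /andP[GRT GRU] g.
have [K K0 undK] := undistorted_bound.
have alphaM : {morph alpha : x y / (x * y)%g} by move=> x y; rewrite gmulfM.
have valM : {morph (val : subgroup_of H -> G) : x y / (x * y)%g >-> (x * y)%g}.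
  by move=> x y; rewrite gmulfM.
have [L L0 LP] := word_length_lipschitz R alphaM genS genS.
have [V V0 VP] := word_length_lipschitz R valM genT genS.
have [A A0 AP] := growth_rate_lt_unif genT l0 GRT.
have [C C0 CP] := growth_rate_lt (piH g) l0 GRU.
have [|B B0 BP] := word_length_lift R piHM genS genU.
  by move=> a; exists (repr a); rewrite /piH reprK.
have ll m : 0 <= l ^+ m by rewrite exprn_ge0// ltW.
have /choice[w wP] : forall m, exists w, piH w = piH (iter m alpha g) /\
    (word_length S w)%:R <= B * C * l ^+ m.
  move=> m; have [w wE leB] := BP (piH (iter m alpha g)); exists w; split=> //.
  apply: (le_trans leB); rewrite -mulrA ler_wpM2l//.
  by rewrite -iter_quotient_endo.
have hH m : ((w m)^-1 * iter m alpha g)%g \in H.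
  by apply/pi_quotientP; have [] := wP m.
have kH m : ((w m.+1)^-1 * alpha (w m))%g \in H.
  apply/pi_quotientP; have [wS _] := wP m.+1; have [wm _] := wP m.
  apply: (etrans wS); rewrite -iter_quotient_endo iterS iter_quotient_endo -wm.
  exact: quotient_endoE.
pose h m : subgroup_of H := Subgroup (hH m).
pose k m : subgroup_of H := Subgroup (kH m).
have hS m : (h m.+1 = k m * restrict_endo alphaH (h m))%g.
  apply: val_inj; rewrite valM /= alphaM mulgA.
  by rewrite -(mulgA _ (alpha (w m))) -alphaM mulgV (morph_one alphaM) mulg1.
have kE m : (word_length T (k m))%:R <= K * (B * C * l + L * (B * C)) * l ^+ m.
  apply: (le_trans (undK _)); rewrite -mulrA ler_wpM2l//=.
  apply: (@le_trans _ _ ((word_length S (w m.+1))%:R +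
                         (word_length S (alpha (w m)))%:R)).
    rewrite -natrD ler_nat; apply: (leq_trans (word_lengthM genS _ _)).
    by rewrite leq_add2r word_lengthV_le.
  rewrite mulrDl -mulrA -exprS; apply: lerD; first by have [] := wP m.+1.
  by apply: (le_trans (LP _)); rewrite -mulrA ler_wpM2l//; have [] := wP m.
have hP := twisted_product_growth genT l0 A0 AP hS kE.
set P := A * _ in hP; set Q := A * _ / l in hP.
exists (B * C + V * P), (V * Q) => m.
have -> : iter m alpha g = (w m * val (h m))%g by rewrite /= mulgA mulgV mul1g.
apply: (@le_trans _ _ ((word_length S (w m))%:R +
                       (word_length S (val (h m)))%:R)).
  by rewrite -natrD ler_nat word_lengthM.
rewrite -addrA mulrDl; apply: lerD; first by have [] := wP m.
apply: (le_trans (VP _)).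
by rewrite [m%:R * _]mulrCA -mulrDr -mulrA ler_wpM2l.
Qed.

End Extension.

Theorem corollary3p1 (R : realType) (Gamma : groupType) (n : nat)
    (s : n.-tuple Gamma) (H : normalClosed Gamma)
    (alpha : group_endo Gamma)
    (gen_s : generates s)
    (fgH : finitely_generated (subgroup_of H))
    (undistH : undistorted R H)
    (alphaH : forall x : Gamma, x \in H -> alpha x \in H)
    (complH : has_complement H s) :
  forall (S : seq Gamma) (T : seq (subgroup_of H)) (U : seq (quotient_by H)),
    generates S -> generates T -> generates U ->
    growth_rate R S alpha
    = maxe (growth_rate R T (restrict_endo alphaH))
           (growth_rate R U (quotient_endo alphaH)).
Proof.
move=> S T U genS genT genU; apply/le_anti/andP; split.
  exact: growth_rate_le_max.
rewrite ge_max; apply/andP; split.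
  exact: growth_rate_restrict_le.
exact: growth_rate_quotient_le.
Qed.
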